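(* Let $F$ be the isotropic (ITQ) or anisotropic (ATQ) truncated quadratic functional, assume $F$ is level-bounded, and let $\{x^t\}$ be a sequence generated by the algorithm preDCA$_e$ for minimizing $F$. Then any accumulation point $\bar x$ of $\{x^t\}$ is a stationary point of $F$, i.e. $0\in\partial F(\bar x)$. Furthermore, $\sum_{t=1}^\infty\|x^t-x^{t-1}\|<\infty$.
   Context: Functionals. $X=\mathbb{R}^{m\times n}$ (identified with $\mathbb{R}^{mn}$), $\lambda,\mu>0$, $A:X\to\mathbb{R}^{m_0\times n_0}$ linear, $x_0\in\mathbb{R}^{m_0\times n_0}$. $\nabla=[\nabla_1,\nabla_2]^T$ is the discrete image gradient, $\nabla_1,\nabla_2:X\to X$ linear forward finite differences with homogeneous Neumann boundary condition: $(\nabla_1x)_{i,j}=x_{i+1,j}-x_{i,j}$ if $i<m$ and $0$ if $i=m$; $(\nabla_2x)_{i,j}=x_{i,j+1}-x_{i,j}$ if $j<n$ and $0$ if $j=n$; $|(\nabla x)_{i,j}|=\sqrt{(\nabla_1x)_{i,j}^2+(\nabla_2x)_{i,j}^2}$. (ITQ): $F(x)=\frac12\|Ax-x_0\|_2^2+\sum_{i,j}\frac\mu2\min(|(\nabla x)_{i,j}|^2,\frac\lambda\mu)$. (ATQ): $F(x)=\frac12\|Ax-x_0\|_2^2+\sum_{i,j}\frac\mu2\sum_{l=1}^2\min(|(\nabla_lx)_{i,j}|^2,\frac\lambda\mu)$. Set $P_1^I(x)=\sum_{i,j}\frac\mu2(|(\nabla x)_{i,j}|^2+\frac\lambda\mu)$,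 $P_2^I(x)=\sum_{i,j}\frac\mu2\max(|(\nabla x)_{i,j}|^2,\frac\lambda\mu)$, $P_1^A(x)=\sum_{i,j}\frac\mu2\sum_{l}(|(\nabla_lx)_{i,j}|^2+\frac\lambda\mu)$, $P_2^A(x)=\sum_{i,j}\frac\mu2\sum_l\max(|(\nabla_lx)_{i,j}|^2,\frac\lambda\mu)$; all are convex. Decomposition $F=f+P_1-P_2$: with $\bullet=I$ for (ITQ) and $\bullet=A$ for (ATQ), either (a) $f(x)=\frac12\|Ax-x_0\|_2^2$, $P_1=P_1^\bullet$, $P_2=P_2^\bullet$; or (b) $f=0$, $P_1(x)=\frac12\|Ax-x_0\|_2^2+P_1^\bullet(x)$, $P_2=P_2^\bullet$. $L\ge0$ is the Lipschitz constant of $\nabla f$ ($L=0$ in case (b)). Metric. $M$ is a self-adjoint linear operator on $X$ with $M\ge L_0\boldsymbol{I}$ (Loewner order), where $L_0>0$ and $L_0\ge L$; $\|x\|_M^2=\langle x,Mx\rangle$. Algorithm preDCA$_e$: take $x^0\in X$, $x^{-1}=x^0$, $\{\beta_t\}\subseteq[0,1)$ with $\sup_t\beta_t<1$; for $t=0,1,\dots$ take $\xi^t\in\partial P_2(x^t)$ (convex subdifferential), set $y^t=x^t+\beta_t(x^t-x^{t-1})$ and $x^{t+1}=\arg\min_y\{\langle\nabla f(y^t)-\xi^t,y\rangle+\frac12\|y-y^t\|_M^2+P_1(y)\}$. Choice of subgradient: $\xi^t=\mu\nabla^*\chi_{x^t}\nabla x^t$ for (ITQ), and $\xi^t=\mu(\nabla_1^*\chi_{x^t,1}\nabla_1+\nabla_2^*\chi_{x^t,2}\nabla_2)x^t$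 for (ATQ), where $\chi_x$ multiplies the pixel $(i,j)$ by $1$ if $|(\nabla x)_{i,j}|\ge\sqrt{\lambda/\mu}$ and by $0$ otherwise, and $\chi_{x,l}$ multiplies the pixel $(i,j)$ by $1$ if $|(\nabla_lx)_{i,j}|\ge\sqrt{\lambda/\mu}$ and by $0$ otherwise. $F$ is level-bounded if $\{x:F(x)\le\alpha\}$ is bounded (possibly empty) for every $\alpha\in\mathbb{R}$. $\partial F$ is the limiting subdifferential: $\xi\in\partial F(x)$ iff there are $x_k\to x$ with $F(x_k)\to F(x)$ and $\xi_k\to\xi$ with $\liminf_{y\to x_k,\,y\ne x_k}\frac{F(y)-F(x_k)-\langle\xi_k,y-x_k\rangle}{|y-x_k|}\ge0$ for every $k$. *)

(* Defs.v *)
From HB Require Import structures.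
From mathcomp Require Import all_boot all_order all_algebra.
From mathcomp Require Import all_classical all_reals all_analysis.
Set Implicit Arguments.
Unset Strict Implicit.
Unset Printing Implicit Defensive.
Import Order.TTheory GRing.Theory Num.Theory numFieldNormedType.Exports.
Local Open Scope classical_set_scope.
Local Open Scope ring_scope.

(* The library norm `|_| on matrices is the max-entry norm.  It is used only
   through its (norm-independent) topology and bounded sets; every metric
   quantity below uses the Euclidean structure given by [dot] and [enorm]. *)
Definition dot (R : realType) (m n : nat) (u v : 'M[R]_(m, n)) : R :=
  \sum_i \sum_j u i j * v i j.

Definition enorm (R : realType) (m n : nat) (u : 'M[R]_(m, n)) : R :=
  Num.sqrt (dot u u).

Definition adjoint (R : realType) (m n m' n' : nat)
    (T : {linear 'M[R]_(m, n) -> 'M[R]_(m', n')}) (v : 'M[R]_(m', n')) :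
    'M[R]_(m, n) :=
  \matrix_(i, j) dot (T (delta_mx i j)) v.

Definition grad (R : realType) (m n : nat) (f : 'M[R]_(m, n) -> R)
    (x : 'M[R]_(m, n)) : 'M[R]_(m, n) :=
  \matrix_(i, j) 'D_(delta_mx i j) f x.

Definition lipschitz_bound (R : realType) (m n : nat)
    (g : 'M[R]_(m, n) -> 'M[R]_(m, n)) (L : R) : Prop :=
  0 <= L /\ forall x y, enorm (g x - g y) <= L * enorm (x - y).

Definition is_lipschitz_constant (R : realType) (m n : nat)
    (g : 'M[R]_(m, n) -> 'M[R]_(m, n)) (L : R) : Prop :=
  lipschitz_bound g L /\ forall L', lipschitz_bound g L' -> L <= L'.

Definition self_adjoint (R : realType) (m n : nat)
    (M : 'M[R]_(m, n) -> 'M[R]_(m, n)) : Prop :=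
  forall x y, dot (M x) y = dot x (M y).

Definition loewner_le (R : realType) (m n : nat)
    (S T : 'M[R]_(m, n) -> 'M[R]_(m, n)) : Prop :=
  forall x, 0 <= dot x (T x - S x).

Definition sqnorm_op (R : realType) (m n : nat)
    (M : 'M[R]_(m, n) -> 'M[R]_(m, n)) (x : 'M[R]_(m, n)) : R :=
  dot x (M x).

Definition convex_subdiff (R : realType) (m n : nat) (P : 'M[R]_(m, n) -> R)
    (x : 'M[R]_(m, n)) : set 'M[R]_(m, n) :=
  [set xi | forall y, P x + dot xi (y - x) <= P y].

Definition regular_subdiff (R : realType) (m n : nat) (F : 'M[R]_(m, n) -> R)
    (x : 'M[R]_(m, n)) : set 'M[R]_(m, n) :=
  [set xi | (0 <= limf_einf
     (fun y => ((F y - F x - dot xi (y - x)) / enorm (y - x))%:E) x^')%E].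

Definition limiting_subdiff (R : realType) (m n : nat) (F : 'M[R]_(m, n) -> R)
    (x : 'M[R]_(m, n)) : set 'M[R]_(m, n) :=
  [set xi | exists x_ xi_ : nat -> 'M[R]_(m, n),
     [/\ x_ k @[k --> \oo] --> x,
         F (x_ k) @[k --> \oo] --> F x,
         xi_ k @[k --> \oo] --> xi &
         forall k, regular_subdiff F (x_ k) (xi_ k)]].

Definition level_bounded (R : realType) (m n : nat) (F : 'M[R]_(m, n) -> R) :
    Prop :=
  forall a : R, bounded_set [set x | F x <= a].

(* Discrete gradient.  Indices start at 0, and [insub i.+1] is [Some] of the
   next index when i.+1 < m and [None] on the last row (resp. column). *)
Definition nabla1 (R : realType) (m n : nat) (x : 'M[R]_(m, n)) :
    'M[R]_(m, n) :=
  \matrix_(i, j) oapp (fun k : 'I_m => x k j - x i j) 0 (insub i.+1).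

Definition nabla2 (R : realType) (m n : nat) (x : 'M[R]_(m, n)) :
    'M[R]_(m, n) :=
  \matrix_(i, j) oapp (fun k : 'I_n => x i k - x i j) 0 (insub j.+1).

Fact nabla1_is_linear (R : realType) (m n : nat) : linear (@nabla1 R m n).
Proof.
move=> a x y; apply/matrixP => i j; rewrite !mxE.
by case: insub => [k|] /=; rewrite ?mxE ?mulr0 ?addr0// mulrBr opprD addrACA.
Qed.

Fact nabla2_is_linear (R : realType) (m n : nat) : linear (@nabla2 R m n).
Proof.
move=> a x y; apply/matrixP => i j; rewrite !mxE.
by case: insub => [k|] /=; rewrite ?mxE ?mulr0 ?addr0// mulrBr opprD addrACA.
Qed.

HB.instance Definition _ (R : realType) (m n : nat) :=
  GRing.isLinear.Build R 'M[R]_(m, n) 'M[R]_(m, n) *:%R (@nabla1 R m n)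
    (@nabla1_is_linear R m n).
HB.instance Definition _ (R : realType) (m n : nat) :=
  GRing.isLinear.Build R 'M[R]_(m, n) 'M[R]_(m, n) *:%R (@nabla2 R m n)
    (@nabla2_is_linear R m n).

Definition nabla_abs (R : realType) (m n : nat) (x : 'M[R]_(m, n))
    (i : 'I_m) (j : 'I_n) : R :=
  Num.sqrt (nabla1 x i j ^+ 2 + nabla2 x i j ^+ 2).

(* Isotropic (ITQ) and anisotropic (ATQ) truncated quadratic models. *)
Variant tq_model := ITQ | ATQ.

(* Where the data term goes in F = f + P1 - P2: into the smooth part f, or
   into P1 (and then f = 0). *)
Variant dc_split := DataInSmooth | DataInP1.

Definition data_term (R : realType) (m n m0 n0 : nat)
    (A : 'M[R]_(m, n) -> 'M[R]_(m0, n0)) (x0 : 'M[R]_(m0, n0))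
    (x : 'M[R]_(m, n)) : R :=
  2^-1 * enorm (A x - x0) ^+ 2.

Definition tq_reg (R : realType) (m n : nat) (md : tq_model) (lam mu : R)
    (x : 'M[R]_(m, n)) : R :=
  match md with
  | ITQ => \sum_i \sum_j mu / 2 * Num.min (nabla_abs x i j ^+ 2) (lam / mu)
  | ATQ => \sum_i \sum_j mu / 2 *
             (Num.min (`|nabla1 x i j| ^+ 2) (lam / mu)
              + Num.min (`|nabla2 x i j| ^+ 2) (lam / mu))
  end.

Definition tq (R : realType) (m n m0 n0 : nat) (md : tq_model) (lam mu : R)
    (A : 'M[R]_(m, n) -> 'M[R]_(m0, n0)) (x0 : 'M[R]_(m0, n0))
    (x : 'M[R]_(m, n)) : R :=
  data_term A x0 x + tq_reg md lam mu x.

Definition quad_reg (R : realType) (m n : nat) (md : tq_model) (lam mu : R)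
    (x : 'M[R]_(m, n)) : R :=
  match md with
  | ITQ => \sum_i \sum_j mu / 2 * (nabla_abs x i j ^+ 2 + lam / mu)
  | ATQ => \sum_i \sum_j mu / 2 *
             ((`|nabla1 x i j| ^+ 2 + lam / mu)
              + (`|nabla2 x i j| ^+ 2 + lam / mu))
  end.

Definition tq_f (R : realType) (m n m0 n0 : nat) (sp : dc_split)
    (A : 'M[R]_(m, n) -> 'M[R]_(m0, n0)) (x0 : 'M[R]_(m0, n0))
    (x : 'M[R]_(m, n)) : R :=
  match sp with
  | DataInSmooth => data_term A x0 x
  | DataInP1 => 0
  end.

Definition tq_P1 (R : realType) (m n m0 n0 : nat) (md : tq_model)
    (sp : dc_split) (lam mu : R)
    (A : 'M[R]_(m, n) -> 'M[R]_(m0, n0)) (x0 : 'M[R]_(m0, n0))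
    (x : 'M[R]_(m, n)) : R :=
  match sp with
  | DataInSmooth => quad_reg md lam mu x
  | DataInP1 => data_term A x0 x + quad_reg md lam mu x
  end.

Definition tq_P2 (R : realType) (m n : nat) (md : tq_model) (lam mu : R)
    (x : 'M[R]_(m, n)) : R :=
  match md with
  | ITQ => \sum_i \sum_j mu / 2 * Num.max (nabla_abs x i j ^+ 2) (lam / mu)
  | ATQ => \sum_i \sum_j mu / 2 *
             (Num.max (`|nabla1 x i j| ^+ 2) (lam / mu)
              + Num.max (`|nabla2 x i j| ^+ 2) (lam / mu))
  end.

Definition pixel_mask (R : realType) (m n : nat) (w : 'I_m -> 'I_n -> R) (s : R)
    (u : 'M[R]_(m, n)) : 'M[R]_(m, n) :=
  \matrix_(i, j) ((s <= w i j)%R%:R * u i j).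

Definition tq_subgrad (R : realType) (m n : nat) (md : tq_model) (lam mu : R)
    (x : 'M[R]_(m, n)) : 'M[R]_(m, n) :=
  let s := Num.sqrt (lam / mu) in
  match md with
  | ITQ =>
      let chi := pixel_mask (nabla_abs x) s in
      mu *: (adjoint (@nabla1 R m n) (chi (nabla1 x))
             + adjoint (@nabla2 R m n) (chi (nabla2 x)))
  | ATQ =>
      let chi1 := pixel_mask (fun i j => `|nabla1 x i j|) s in
      let chi2 := pixel_mask (fun i j => `|nabla2 x i j|) s in
      mu *: (adjoint (@nabla1 R m n) (chi1 (nabla1 x))
             + adjoint (@nabla2 R m n) (chi2 (nabla2 x)))
  end.

Definition is_argmin (T : Type) (R : realType) (G : T -> R) (z : T) : Prop :=
  forall y, G z <= G y.

(* [x t.-1] is x^{t-1}, with the convention x^{-1} = x^0 since 0.-1 = 0. *)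
Definition preDCAe (R : realType) (m n : nat) (f P1 P2 : 'M[R]_(m, n) -> R)
    (M : 'M[R]_(m, n) -> 'M[R]_(m, n)) (beta : nat -> R)
    (x xi : nat -> 'M[R]_(m, n)) : Prop :=
  [/\ forall t, 0 <= beta t < 1,
      sup (range beta) < 1 &
      forall t,
        convex_subdiff P2 (x t) (xi t) /\
        let y := x t + beta t *: (x t - x t.-1) in
        is_argmin
          (fun z => dot (grad f y - xi t) z + 2^-1 * sqnorm_op M (z - y) + P1 z)
          (x t.+1)].

Lemma adjointP (R : realType) (m n m' n' : nat)
    (T : {linear 'M[R]_(m, n) -> 'M[R]_(m', n')}) u v :
  dot u (adjoint T v) = dot (T u) v.
Proof.
have dotZl a (w : 'M[R]_(m', n')) : dot (a *: w) v = a * dot w v.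
  rewrite /dot mulr_sumr; apply: eq_bigr => i _; rewrite mulr_sumr.
  by apply: eq_bigr => j _; rewrite mxE mulrA.
have dotDl : {morph (fun w : 'M[R]_(m', n') => dot w v) : w z / w + z}.
  move=> w z; rewrite /dot -big_split; apply: eq_bigr => i _.
  by rewrite -big_split; apply: eq_bigr => j _; rewrite mxE mulrDl.
have dot0l : dot (0 : 'M[R]_(m', n')) v = 0.
  by rewrite -(scale0r (0 : 'M[R]_(m', n'))) dotZl mul0r.
rewrite {2}[u]matrix_sum_delta linear_sum (big_morph _ dotDl dot0l).
apply: eq_bigr => i _; rewrite linear_sum (big_morph _ dotDl dot0l).
by apply: eq_bigr => j _; rewrite linearZ dotZl mxE.
Qed.

Lemma tq_decomposition (R : realType) (m n m0 n0 : nat) (md : tq_model)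
    (sp : dc_split) (lam mu : R)
    (A : 'M[R]_(m, n) -> 'M[R]_(m0, n0)) (x0 : 'M[R]_(m0, n0)) x :
  tq md lam mu A x0 x =
  tq_f sp A x0 x + tq_P1 md sp lam mu A x0 x - tq_P2 md lam mu x.
Proof.
have -> : tq_f sp A x0 x + tq_P1 md sp lam mu A x0 x =
  data_term A x0 x + quad_reg md lam mu x by case: sp; rewrite /= ?add0r.
rewrite /tq -addrA; congr (_ + _).
have mm (a b : R) : Num.min a b = a + b - Num.max a b.
  by rewrite -(addr_max_min a b) addrC addrA addNr add0r.
case: md => /=; rewrite -sumrB; apply: eq_bigr => i _;
  rewrite -sumrB; apply: eq_bigr => j _; rewrite -mulrBr; congr (_ * _).
  exact: mm.
by rewrite !mm opprD addrACA.
Qed.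

(* Main.v *)
Require Import Defs.
From HB Require Import structures.
From mathcomp Require Import all_boot all_order all_algebra.
From mathcomp Require Import all_classical all_reals all_analysis.
From mathcomp Require Import ring lra.
Import Order.TTheory GRing.Theory Num.Theory numFieldNormedType.Exports.
Local Open Scope classical_set_scope.
Local Open Scope ring_scope.
Set Implicit Arguments.
Unset Strict Implicit.
Unset Printing Implicit Defensive.

(* F is a minimum of finitely many convex quadratics Q_c, one for each choice c
   of truncated pixels.  The prescribed subgradient makes
   grad f(x^t) + grad P_1(x^t) - xi^t the gradient of the piece Q_{c_t} selected
   at x^t, so the optimality condition of the algorithm bounds
   |grad Q_{c_t}(x^t)|^2 by C (a_t + a_{t+1}), where a_t = |x^t - x^{t-1}|^2.
   A quadratic exceeds its minimum value by at most a multiple of its squared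
   gradient, and E_t = F(x^t) + |x^t - x^{t-1}|_M^2 / 2 decreases by at least a
   multiple of a_t.  Hence a_t tends to 0 and min Q_{c_t} tends to lim E; these
   minima take finitely many values, so they eventually equal lim E, and
   E_t - lim E is bounded by a multiple of E_t - E_{t+2}.  Taking square roots
   and telescoping gives the finite length.
   Stationarity: for small e > 0, F coincides with Q_{c_t} near (1 + e) x^t, so
   grad Q_{c_t}(x^t), which tends to 0, is a limit of regular subgradients. *)

(** * The Euclidean inner product on matrices and adjoints *)

Lemma dotC (R : realType) m n (u v : 'M[R]_(m, n)) : dot u v = dot v u.
Proof. by apply: eq_bigr => i _; apply: eq_bigr => j _; rewrite mulrC. Qed.

Lemma dotDl (R : realType) m n (u v w : 'M[R]_(m, n)) :
  dot (u + v) w = dot u w + dot v w.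
Proof.
rewrite /dot -big_split; apply: eq_bigr => i _.
by rewrite -big_split; apply: eq_bigr => j _; rewrite mxE mulrDl.
Qed.

Lemma dotZl (R : realType) m n a (u v : 'M[R]_(m, n)) :
  dot (a *: u) v = a * dot u v.
Proof.
rewrite /dot mulr_sumr; apply: eq_bigr => i _; rewrite mulr_sumr.
by apply: eq_bigr => j _; rewrite mxE mulrA.
Qed.

Lemma dotNl (R : realType) m n (u v : 'M[R]_(m, n)) : dot (- u) v = - dot u v.
Proof. by rewrite -scaleN1r dotZl mulN1r. Qed.

Lemma dotBl (R : realType) m n (u v w : 'M[R]_(m, n)) :
  dot (u - v) w = dot u w - dot v w.
Proof. by rewrite dotDl dotNl. Qed.

Lemma dotDr (R : realType) m n (u v w : 'M[R]_(m, n)) :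
  dot w (u + v) = dot w u + dot w v.
Proof. by rewrite !(dotC w) dotDl. Qed.

Lemma dotZr (R : realType) m n a (u v : 'M[R]_(m, n)) :
  dot v (a *: u) = a * dot v u.
Proof. by rewrite !(dotC v) dotZl. Qed.

Lemma dotNr (R : realType) m n (u v : 'M[R]_(m, n)) : dot v (- u) = - dot v u.
Proof. by rewrite !(dotC v) dotNl. Qed.

Lemma dotBr (R : realType) m n (u v w : 'M[R]_(m, n)) :
  dot w (u - v) = dot w u - dot w v.
Proof. by rewrite !(dotC w) dotBl. Qed.

Lemma dot0l (R : realType) m n (v : 'M[R]_(m, n)) : dot 0 v = 0.
Proof. by rewrite -(scale0r 0) dotZl mul0r. Qed.

Lemma dot0r (R : realType) m n (v : 'M[R]_(m, n)) : dot v 0 = 0.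
Proof. by rewrite dotC dot0l. Qed.

Lemma dot_delta (R : realType) m n (u : 'M[R]_(m, n)) i j :
  dot u (delta_mx i j) = u i j.
Proof.
rewrite /dot (bigD1 i) //= (bigD1 j) //= !mxE !eqxx mulr1.
rewrite big1 ?addr0 => [|k ne]; last by rewrite mxE (negPf ne) andbF mulr0.
rewrite big1 ?addr0 // => k ne.
by rewrite big1 // => l _; rewrite mxE (negPf ne) mulr0.
Qed.

Lemma dot_ext (R : realType) m n (u v : 'M[R]_(m, n)) :
  (forall w, dot w u = dot w v) -> u = v.
Proof.
by move=> e; apply/matrixP => i j; rewrite -!dot_delta !(dotC _ (delta_mx _ _)).
Qed.

Lemma dot_ge0 (R : realType) m n (u : 'M[R]_(m, n)) : 0 <= dot u u.
Proof. by do 2![apply: sumr_ge0 => ? _]; rewrite -expr2 sqr_ge0. Qed.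

Lemma sqr_coord_le_dot (R : realType) m n (u : 'M[R]_(m, n)) i j :
  u i j ^+ 2 <= dot u u.
Proof.
rewrite /dot (bigD1 i) //= (bigD1 j) //= -expr2 -addrA lerDl.
by rewrite addr_ge0// ?sumr_ge0// => k _; rewrite ?sumr_ge0// => *;
  rewrite -expr2 sqr_ge0.
Qed.

Lemma dot_eq0 (R : realType) m n (u : 'M[R]_(m, n)) : dot u u = 0 -> u = 0.
Proof.
move=> u0; apply/matrixP => i j; rewrite mxE; apply/eqP.
by rewrite -sqrf_eq0 eq_le sqr_ge0 -u0 sqr_coord_le_dot.
Qed.

Lemma CauchySchwarz_dot (R : realType) m n (u v : 'M[R]_(m, n)) :
  dot u v ^+ 2 <= dot u u * dot v v.
Proof.
have [v0|v0] := eqVneq (dot v v) 0.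
  by rewrite (dot_eq0 v0) !dot0r expr0n mulr0.
(* The squared norm of this vector is [dot v v] times the gap in the inequality. *)
have := dot_ge0 (dot v v *: u - dot u v *: v).
rewrite !(dotBl, dotBr, dotZl, dotZr) (dotC v u) => h.
have vp : 0 < dot v v by rewrite lt0r v0 dot_ge0.
rewrite -subr_ge0 -(pmulr_rge0 _ vp); apply: (le_trans h).
by rewrite le_eqVlt; apply/orP; left; apply/eqP; ring.
Qed.

Lemma sqr_dotD_le (R : realType) m n (u v : 'M[R]_(m, n)) :
  dot (u + v) (u + v) <= 2 * (dot u u + dot v v).
Proof.
have := dot_ge0 (u - v).
by rewrite !(dotBl, dotBr, dotDl, dotDr) (dotC v u); lra.
Qed.

Lemma enorm_sqr (R : realType) m n (u : 'M[R]_(m, n)) : enorm u ^+ 2 = dot u u.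
Proof. by rewrite sqr_sqrtr ?dot_ge0. Qed.

Lemma dot_le_enorm (R : realType) m n (u v : 'M[R]_(m, n)) :
  dot u v <= enorm u * enorm v.
Proof.
rewrite -sqrtrM ?dot_ge0//; apply: le_trans (ler_norm _) _.
by rewrite -sqrtr_sqr ler_sqrt ?mulr_ge0 ?dot_ge0// CauchySchwarz_dot.
Qed.

Lemma adjoint_is_linear (R : realType) m n m' n'
    (T : {linear 'M[R]_(m, n) -> 'M[R]_(m', n')}) : linear (adjoint T).
Proof.
by move=> a u v; apply: dot_ext => w; rewrite !(dotDr, dotZr, adjointP).
Qed.

HB.instance Definition _ (R : realType) m n m' n'
    (T : {linear 'M[R]_(m, n) -> 'M[R]_(m', n')}) :=
  GRing.isLinear.Build R 'M[R]_(m', n') 'M[R]_(m, n) *:%R (adjoint T)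
    (adjoint_is_linear T).

Lemma linear_coordE (R : realType) m n m' n'
    (T : {linear 'M[R]_(m, n) -> 'M[R]_(m', n')}) u i j :
  T u i j = dot u (adjoint T (delta_mx i j)).
Proof. by rewrite adjointP dot_delta. Qed.

(** Each entry of [T u] is the inner product of [u] with a fixed matrix, so Cauchy-Schwarz applies
    entrywise; the constant is the squared Hilbert-Schmidt norm of [T]. *)
Lemma linear_dot_bounded (R : realType) m n m' n'
    (T : {linear 'M[R]_(m, n) -> 'M[R]_(m', n')}) :
  exists2 C, 0 <= C & forall u, dot (T u) (T u) <= C * dot u u.
Proof.
exists (\sum_i \sum_j
    dot (adjoint T (delta_mx i j)) (adjoint T (delta_mx i j))) => [|u].
  by do 2![apply: sumr_ge0 => ? _]; exact: dot_ge0.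
rewrite {1}/dot mulr_suml; apply: ler_sum => i _.
rewrite mulr_suml; apply: ler_sum => j _.
by rewrite -expr2 linear_coordE mulrC CauchySchwarz_dot.
Qed.

(** * Convex quadratics, given by their exact second-order expansion *)

Record quadratic (R : realType) m n (q : 'M[R]_(m, n) -> R)
    (g : 'M[R]_(m, n) -> 'M[R]_(m, n))
    (H : {linear 'M[R]_(m, n) -> 'M[R]_(m, n)}) : Prop := Quadratic {
  quadE : forall x h, q (x + h) = q x + dot (g x) h + 2^-1 * dot h (H h);
  quad_gradE : forall x h, g (x + h) = g x + H h;
  quad_sym : self_adjoint H;
  quad_ge0 : forall h, 0 <= dot h (H h) }.

Lemma quadratic_lsq (R : realType) m n m' n'
    (T : {linear 'M[R]_(m, n) -> 'M[R]_(m', n')}) b :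
  quadratic (fun x => 2^-1 * dot (T x - b) (T x - b))
    (fun x => adjoint T (T x - b)) (adjoint T \o T).
Proof.
split=> [x h|x h|x y|h] /=.
- rewrite (linearD T) addrAC -!(dotC h) !adjointP.
  by rewrite !(dotDl _ (T h)) !(dotDr _ (T h)) (dotC _ (T h)); field.
- by rewrite (linearD T) addrAC linearD.
- by rewrite adjointP dotC adjointP dotC.
- by rewrite adjointP dot_ge0.
Qed.

Lemma quadraticD (R : realType) m n (q q' : 'M[R]_(m, n) -> R) g g' H H' :
  quadratic q g H -> quadratic q' g' H' ->
  quadratic (fun x => q x + q' x) (fun x => g x + g' x) (H \+ H').
Proof.
case=> e1 e2 e3 e4 [e1' e2' e3' e4']; split=> [x h|x h|x y|h] /=.
- by rewrite e1 e1' dotDl dotDr; ring.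
- by rewrite e2 e2' addrACA.
- by rewrite dotDl dotDr e3 e3'.
- by rewrite dotDr addr_ge0.
Qed.

Lemma quadraticZ (R : realType) m n a (q : 'M[R]_(m, n) -> R) g H :
  0 <= a -> quadratic q g H ->
  quadratic (fun x => a * q x) (fun x => a *: g x) (a \*: H).
Proof.
move=> a0 [e1 e2 e3 e4]; split=> [x h|x h|x y|h] /=.
- by rewrite e1 dotZl dotZr; ring.
- by rewrite e2 scalerDr.
- by rewrite dotZl dotZr e3.
- by rewrite dotZr mulr_ge0.
Qed.

Lemma quadratic_cst (R : realType) m n (k : R) :
  quadratic (fun=> k) (fun=> 0 : 'M[R]_(m, n)) \0.
Proof.
by split=> [x h|x h|x y|h] /=; rewrite ?dot0l ?dot0r ?mulr0 ?addr0.
Qed.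

Lemma quadratic_linear (R : realType) m n (v : 'M[R]_(m, n)) :
  quadratic (dot v) (fun=> v) \0.
Proof.
by split=> [x h|x h|x y|h] /=; rewrite ?dotDr ?dot0l ?dot0r ?mulr0 ?addr0.
Qed.

Lemma quadratic_op (R : realType) m n
    (M : {linear 'M[R]_(m, n) -> 'M[R]_(m, n)}) y :
  self_adjoint M -> (forall h, 0 <= dot h (M h)) ->
  quadratic (fun z => 2^-1 * sqnorm_op M (z - y)) (fun z => M (z - y)) M.
Proof.
move=> Ms M0; split=> [x h|x h|//|//]; last by rewrite addrAC linearD.
rewrite addrAC; move: (x - y) => w.
rewrite /sqnorm_op linearD !(dotDl, dotDr) (dotC h (M w)) Ms.
by field.
Qed.

Lemma quadratic_argmin (R : realType) m n (q : 'M[R]_(m, n) -> R) g H z :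
  quadratic q g H -> is_argmin q z -> g z = 0.
Proof.
move=> [e _ _ p] zmin; apply: dot_eq0; apply/eqP; rewrite eq_le dot_ge0 andbT.
set a := dot _ _; rewrite leNgt; apply/negP => a0.
pose b := 2^-1 * dot (g z) (H (g z)).
have b0 : 0 <= b by rewrite mulr_ge0// invr_ge0.
have b1 : 0 < 1 + b by rewrite ltr_pwDl.
(* With this step length, moving from [z] by [- s *: g z] changes [q] by exactly [- s ^+ 2], which
   contradicts minimality. *)
have [s sa s0] : exists2 s, s * (1 + b) = a & 0 < s.
  by exists (a / (1 + b)); [rewrite divfK// gt_eqF | rewrite divr_gt0].
have := zmin (z + (- s) *: g z).
rewrite e (linearZ_LR H) !dotZl !dotZr -/a.
have -> : 2^-1 * (- s * (- s * dot (g z) (H (g z)))) = s * (s * b).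
  by rewrite /b; ring.
apply/negP; rewrite -ltNge -addrA gtrDl -sa.
by rewrite -[ltLHS]opprK oppr_lt0; nra.
Qed.

Lemma quadratic_grad (R : realType) m n (q : 'M[R]_(m, n) -> R) g H :
  quadratic q g H -> grad q = g.
Proof.
move=> [e _ _ _]; apply/funext => x; apply/matrixP => i j; rewrite mxE.
rewrite -(dot_delta (g x)); set d := delta_mx i j.
apply: cvg_lim => //.
have : (dot (g x) d + 2^-1 * (h * dot d (H d)))%R @[h --> (0 : R)^'] -->
    dot (g x) d + 2^-1 * (0 * dot d (H d)).
  apply: cvgD; first exact: cvg_cst.
  apply: cvgMr; apply: cvgMl; exact: cvg_within.
rewrite mul0r mulr0 addr0; apply: cvg_trans; apply: near_eq_cvg.
near=> h.
have h0 : h != 0 by near: h; exact: nbhs_dnbhs_neq.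
rewrite /= [h *: d + x]addrC e (linearZ_LR H) !dotZl !dotZr /GRing.scale /=.
by field.
Unshelve. all: by end_near.
Qed.

(** A bridge to row vectors, where row spaces and cokernels express orthogonality to the kernel of a
    Hessian. *)
Lemma dot_mxvec (R : realType) m n (u v : 'M[R]_(m, n)) :
  dot u v = (mxvec u *m (mxvec v)^T) 0 0.
Proof.
rewrite mxE (reindex _ (curry_mxvec_bij m n)) /dot pair_bigA /=.
by apply: eq_bigr => -[i j] _; rewrite mxE /= !mxvecE.
Qed.

(* A gradient of a bounded below quadratic is orthogonal to the kernel of the
   Hessian, hence lies in its range: this yields a minimiser, and a
   pseudo-inverse of the Hessian bounds the excess by the squared gradient. *)
Lemma quadratic_error_bound (R : realType) m n (q : 'M[R]_(m, n) -> R) g H B :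
  quadratic q g H -> (forall x, B <= q x) ->
  exists qmin C, 0 <= C /\
    forall x, qmin <= q x <= qmin + C * dot (g x) (g x).
Proof.
move=> [e1 e2 sym p] qB.
(* Along a kernel direction [q] is affine; with a nonzero slope it would take the value [B - 1] at
   the chosen point. *)
have orth w : H w = 0 -> dot (g 0) w = 0.
  move=> Hw; apply/eqP; apply/negP => /negP d0.
  have := qB (0 + (- ((q 0 - B + 1) / dot (g 0) w)) *: w).
  rewrite e1 (linearZ_LR H) Hw !scaler0 dot0r mulr0 addr0 dotZr mulNr divfK//.
  by lra.
pose G := lin_mx H.
have /submxP[c cE] : (mxvec (g 0) <= G)%MS.
  (* Membership in the row space is tested against the columns of the cokernel; by symmetry of [H],
     each of them, reshaped as a matrix, lies in the kernel of [H]. *)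
  rewrite submxE; apply/eqP/rowP => k; rewrite [RHS]mxE.
  pose w : 'M[R]_(m, n) := vec_mx (col k (cokermx G))^T.
  have Hw : H w = 0.
    apply: dot_ext => u.
    rewrite -sym dot0r dot_mxvec -mul_vec_lin vec_mxK trmxK.
    by rewrite -mulmxA colE (mulmxA G) mulmx_coker mul0mx mulmx0 mxE.
  rewrite -(orth _ Hw) dot_mxvec vec_mxK trmxK !mxE.
  by apply: eq_bigr => l _; rewrite !mxE.
pose z : 'M[R]_(m, n) := - vec_mx c.
have gz : g z = 0.
  by rewrite -[z]add0r e2 linearN -[g 0]mxvecK cE mul_rV_lin mxvecK subrr.
(* [K] below is the pseudo-inverse of [H]; only the identity H K H = H and its boundedness
   matter. *)
have [C C0 CE] := linear_dot_bounded
  (vec_mx \o mulmxr (pinvmx G) \o mxvec :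
     {linear 'M[R]_(m, n) -> 'M[R]_(m, n)}).
set K := (_ \o _) in CE.
have HKH u : H (K (H u)) = H u.
  apply: (can_inj mxvecK); rewrite -!(mul_vec_lin H) /K /= vec_mxK.
  by rewrite mulmxKpV -?(mul_vec_lin H) ?submxMl.
exists (q z), (1 + C); split=> [|x]; first by rewrite addr_ge0.
rewrite -{1 2 3 4}[x](subrKC z) e1 e2 gz add0r dot0l addr0.
set h := x - z; rewrite lerDl mulr_ge0 ?invr_ge0//= lerD2l.
(* Since [g x] is [H h], the excess is half of the product of [g x] with [K (g x)], which Young's
   inequality and the bound on [K] control. *)
have -> : dot h (H h) = dot (H h) (K (H h)) by rewrite -{1}HKH -sym.
have := CE (H h); have := dot_ge0 (H h - K (H h)); have := dot_ge0 (H h).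
rewrite !(dotBl, dotBr) (dotC (K _) (H h)) mulrDl mul1r.
have := dot_ge0 (K (H h)).
by lra.
Qed.

(** * Scalar sequences: descent towards finitely many values *)

(** An index whose value differs from [l] stays at a positive distance from it, hence is eventually
    never visited; finiteness of [I] makes this uniform. *)
Lemma finite_limit_attained (R : realType) (I : finType) (q : I -> R)
    (s : nat -> I) (l : R) :
  q (s t) @[t --> \oo] --> l -> \forall t \near \oo, q (s t) = l.
Proof.
move=> ql.
have : \forall t \near \oo, forall i, s t = i -> q i = l.
  apply: filter_forall => i; have [<-|ne] := eqVneq (q i) l.
    by near=> t.
  have d0 : 0 < `|l - q i| by rewrite normr_gt0 subr_eq0 eq_sym.
  move/cvgrPdist_lt : ql => /(_ _ d0); apply: filterS => t lt st.
  by move: lt; rewrite st ltxx.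
by apply: filterS => t; apply.
Unshelve. all: by end_near.
Qed.

(** With u, v the roots of r, r', factor r - r' = (u - v)(u + v) <= 2u(u - v) and divide by u. The
    result is a bound that telescopes. *)
Lemma sqrt_contraction (R : realType) (K r r' : R) :
  0 <= r' -> r' <= r -> r <= K * (r - r') ->
  Num.sqrt r <= 2 * K * (Num.sqrt r - Num.sqrt r').
Proof.
move=> r'0 r'r rK.
have := sqr_sqrtr r'0; have := sqr_sqrtr (le_trans r'0 r'r).
have := ler_wsqrtr r'r; have := sqrtr_ge0 r'.
move: (Num.sqrt r) (Num.sqrt r') => u v v0 vu ur vr.
have [u0|] := eqVneq u 0.
  have v0' : v = 0 by apply: le_anti; rewrite v0 andbT -u0.
  by rewrite v0' u0 subr0 mulr0.
move=> u0; have up : 0 < u by lra.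
(* A negative [K] would force [r <= 0], because [r - r'] is nonnegative. *)
have K0 : 0 <= K.
  have [//|Kn] := leP 0 K.
  have : 0 < r by rewrite -ur exprn_gt0.
  by nra.
rewrite -(ler_pM2l up); apply: (@le_trans _ _ (K * ((u - v) * (u + v)))).
  have -> : K * ((u - v) * (u + v)) = K * (r - r') by rewrite -ur -vr; ring.
  by rewrite -expr2 ur.
have : (u - v) * (u + v) <= (u - v) * (u + u).
  by apply: ler_wpM2l; lra.
move/(ler_wpM2l K0) => /le_trans; apply.
by rewrite le_eqVlt; apply/orP; left; apply/eqP; ring.
Qed.

(** The scalar core of the convergence proof: [q (s t)] stands for the minimum of the active piece,
    [F] for the objective, [E] for the energy and [a] for the squared step lengths. *)
Lemma finite_value_descent (R : realType) (I : finType) (q : I -> R)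
    (s : nat -> I) (F E a : nat -> R) (c C : R) :
  0 < c -> 0 <= C -> (forall t, 0 <= a t) -> (forall t, 0 <= E t) ->
  (forall t, E t.+1 + c * a t <= E t) ->
  (forall t, F t <= E t <= F t + C * a t) ->
  (forall t, q (s t) <= F t <= q (s t) + C * (a t + a t.+1)) ->
  a t @[t --> \oo] --> 0 /\
  exists B, forall T, \sum_(0 <= t < T) Num.sqrt (a t) <= B.
Proof.
move=> c0 C0 a0 E0 Edec EF qF.
have Emon : {homo E : k l / (k <= l)%N >-> l <= k}.
  apply/nonincreasing_seqP => t; apply: le_trans (Edec t).
  by rewrite lerDl mulr_ge0 ?(ltW c0).
have Elb : has_lbound (range E) by exists 0 => _ [t _ <-].
have := nonincreasing_cvgn Emon Elb; set l := inf _ => El.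
have lE t : l <= E t by apply: ge_inf => //; exists t.
have ES : E t.+1 @[t --> \oo] --> l by rewrite (cvg_shiftS E).
have acvg : a t @[t --> \oo] --> 0.
  have h : (c^-1 * (E t - E t.+1) : R) @[t --> \oo] --> 0.
    rewrite -(mulr0 c^-1) -(subrr l); apply: cvgMr.
    exact: cvgB El ES.
  apply: squeeze_cvgr h => /=; last exact: cvg_cst.
  near=> t; rewrite a0 /= mulrC ler_pdivlMr// mulrC.
  by have := Edec t; lra.
split=> //.
have aS : a t.+1 @[t --> \oo] --> 0 by rewrite (cvg_shiftS a).
(* [q (s t)] lies below [E t] and above [E t] minus error terms that tend to 0. *)
have /finite_limit_attained [N _ Nl] : q (s t) @[t --> \oo] --> l.
  have h : (E t - C * a t - C * (a t + a t.+1) : R) @[t --> \oo] --> l.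
    have -> : l = l - C * 0 - C * (0 + 0) by rewrite addr0 mulr0 !subr0.
    apply: cvgB; last by apply: cvgMr; exact: cvgD acvg aS.
    by apply: cvgB El _; exact: cvgMr acvg.
  apply: squeeze_cvgr h El; near=> t.
  by have := EF t; have := qF t; lra.
pose r t := E t - l.
have r0 t : 0 <= r t by rewrite subr_ge0.
have rmon t k : r (t + k)%N <= r t by rewrite lerB// Emon// leq_addr.
(* From [N] on, the error bounds give [r t <= (2 * C + 1) * (a t + a t.+1)], and two descent steps
   bound [c * (a t + a t.+1)] by [r t - r (t + 2)]. *)
pose K := (2 * C + 1) / c.
have K0 : 0 <= K by rewrite divr_ge0 ?(ltW c0)//; lra.
have rK t : (N <= t)%N -> r t <= K * (r t - r (t + 2)%N).
  move=> Nt.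
  have h1 : r t <= (2 * C + 1) * (a t + a t.+1).
    have := EF t; have := qF t; rewrite (Nl t Nt) /r.
    have := a0 t; have := a0 t.+1 => *.
    have h1 := mulr_ge0 C0 (a0 t); have h2 := mulr_ge0 C0 (a0 t.+1).
    by lra.
  apply: le_trans h1 _; rewrite /K -mulrA; apply: ler_wpM2l; first by lra.
  rewrite mulrC ler_pdivlMr// addn2 /r.
  by have := Edec t; have := Edec t.+1; lra.
pose u t := Num.sqrt (r t).
have uK t : (N <= t)%N -> u t <= 2 * K * (u t - u (t + 2)%N).
  by move=> Nt; apply: sqrt_contraction; [exact: r0|exact: rmon|exact: rK].
(* Differences of indices two apart telescope to two boundary terms, so the induction carries
   both. *)
have sumu T : \sum_(N <= t < N + T) u t + 2 * K * (u (N + T)%N + u (N + T).+1)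
    <= 2 * K * (u N + u N.+1).
  elim: T => [|T IH]; first by rewrite addn0 big_geq// add0r.
  rewrite addnS big_nat_recr ?leq_addr//=.
  have := uK (N + T)%N (leq_addr _ _); rewrite addn2.
  by lra.
exists (\sum_(0 <= t < N) Num.sqrt (a t)
        + Num.sqrt c^-1 * (2 * K * (u N + u N.+1))) => T.
apply: (@le_trans _ _ (\sum_(0 <= t < N + T) Num.sqrt (a t))).
  rewrite [leRHS](@big_cat_nat _ _ _ T)//= ?leq_addl// lerDl.
  by apply: sumr_ge0 => t _; exact: sqrtr_ge0.
rewrite (@big_cat_nat _ _ _ N)//= ?leq_addr// lerD2l.
(* Descent gives [c * a t <= E t - E t.+1 <= r t], hence the factor [Num.sqrt c^-1]. *)
apply: (@le_trans _ _ (Num.sqrt c^-1 * \sum_(N <= t < N + T) u t)).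
  rewrite mulr_sumr; apply: ler_sum => t _.
  rewrite -sqrtrM ?invr_ge0 ?(ltW c0)//; apply: ler_wsqrtr.
  rewrite mulrC ler_pdivlMr// mulrC /r.
  by have := Edec t; have := lE t.+1; lra.
apply: ler_wpM2l; first exact: sqrtr_ge0.
apply: le_trans (sumu T); rewrite lerDl; do 2?[apply: mulr_ge0 => //].
by rewrite addr_ge0//; exact: sqrtr_ge0.
Unshelve. all: by end_near.
Qed.

(** * The quadratic pieces of F *)

Lemma quadratic_ext (R : realType) m n (q q' : 'M[R]_(m, n) -> R) g g' H :
  q =1 q' -> g =1 g' -> quadratic q g H -> quadratic q' g' H.
Proof. by move=> /funext -> /funext ->. Qed.

Lemma quadratic_sq (R : realType) m n m' n'
    (T : {linear 'M[R]_(m, n) -> 'M[R]_(m', n')}) :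
  quadratic (fun x => 2^-1 * dot (T x) (T x)) (fun x => adjoint T (T x))
    (adjoint T \o T).
Proof.
by apply: quadratic_ext (quadratic_lsq T 0) => x; rewrite !subr0.
Qed.

(** The flagged entries are the truncated pixels, so this is complementary to [pixel_mask]: it keeps
    what is still penalised quadratically. *)
Definition mask0 (R : realType) m n (c : 'M[bool]_(m, n)) (u : 'M[R]_(m, n)) :=
  \matrix_(i, j) (if c i j then 0 else u i j).

Lemma mask0E (R : realType) m n (c : 'M[bool]_(m, n)) (u : 'M[R]_(m, n)) i j :
  mask0 c u i j = if c i j then 0 else u i j.
Proof. by rewrite mxE. Qed.

Lemma mask0_is_linear (R : realType) m n (c : 'M[bool]_(m, n)) :
  linear (@mask0 R m n c).
Proof.
by move=> a u v; apply/matrixP => i j; rewrite !mxE; case: ifP;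
  rewrite ?mulr0 ?addr0.
Qed.

HB.instance Definition _ (R : realType) m n (c : 'M[bool]_(m, n)) :=
  GRing.isLinear.Build R 'M[R]_(m, n) 'M[R]_(m, n) *:%R (@mask0 R m n c)
    (@mask0_is_linear R m n c).

(** Masking is an orthogonal projection, which is why a single mask suffices in the gradient of a
    piece. *)
Lemma dot_mask0 (R : realType) m n (c : 'M[bool]_(m, n)) (u v : 'M[R]_(m, n)) :
  dot (mask0 c u) (mask0 c v) = dot u (mask0 c v).
Proof.
apply: eq_bigr => i _; apply: eq_bigr => j _; rewrite !mxE.
by case: (c i j); rewrite ?mulr0.
Qed.

(** The flag selects the direction of the difference. For ITQ both directions share one weight, so
    that a pair of masks describes either model. *)
Definition tq_weight (R : realType) m n (md : tq_model) (l : bool)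
    (x : 'M[R]_(m, n)) (i : 'I_m) (j : 'I_n) : R :=
  match md with
  | ITQ => nabla_abs x i j
  | ATQ => if l then `|nabla2 x i j| else `|nabla1 x i j|
  end.

Definition tq_trunc (R : realType) m n (md : tq_model) (s : R)
    (x : 'M[R]_(m, n)) : 'M[bool]_(m, n) * 'M[bool]_(m, n) :=
  (\matrix_(i, j) (s <= tq_weight md false x i j),
   \matrix_(i, j) (s <= tq_weight md true x i j)).

Lemma tq_truncE1 (R : realType) m n md s (x : 'M[R]_(m, n)) i j :
  (tq_trunc md s x).1 i j = (s <= tq_weight md false x i j).
Proof. by rewrite mxE. Qed.

Lemma tq_truncE2 (R : realType) m n md s (x : 'M[R]_(m, n)) i j :
  (tq_trunc md s x).2 i j = (s <= tq_weight md true x i j).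
Proof. by rewrite mxE. Qed.

Definition tq_piece_cst (R : realType) m n (md : tq_model) (lam mu : R)
    (c : 'M[bool]_(m, n) * 'M[bool]_(m, n)) : R :=
  \sum_i \sum_j mu / 2 * match md with
    | ITQ => if c.1 i j then lam / mu else 0
    | ATQ => (if c.1 i j then lam / mu else 0)
             + (if c.2 i j then lam / mu else 0)
    end.

(* The quadratic obtained by truncating exactly at the pixels of [c]; for ITQ
   the two masks of [tq_trunc] coincide and the constant counts them once. *)
Definition tq_piece (R : realType) m n m0 n0 (md : tq_model) (lam mu : R)
    (A : 'M[R]_(m, n) -> 'M[R]_(m0, n0)) (x0 : 'M[R]_(m0, n0))
    (c : 'M[bool]_(m, n) * 'M[bool]_(m, n)) (x : 'M[R]_(m, n)) : R :=
  2^-1 * dot (A x - x0) (A x - x0) +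
  mu * (2^-1 * dot (mask0 c.1 (nabla1 x)) (mask0 c.1 (nabla1 x))
        + 2^-1 * dot (mask0 c.2 (nabla2 x)) (mask0 c.2 (nabla2 x))) +
  tq_piece_cst md lam mu c.

Definition tq_piece_grad (R : realType) m n m0 n0 (mu : R)
    (A : {linear 'M[R]_(m, n) -> 'M[R]_(m0, n0)}) (x0 : 'M[R]_(m0, n0))
    (c : 'M[bool]_(m, n) * 'M[bool]_(m, n)) (x : 'M[R]_(m, n)) :
    'M[R]_(m, n) :=
  adjoint A (A x - x0) +
  mu *: (adjoint (@nabla1 R m n) (mask0 c.1 (nabla1 x))
         + adjoint (@nabla2 R m n) (mask0 c.2 (nabla2 x))).

Lemma quadratic_mask0 (R : realType) m n m' n' (c : 'M[bool]_(m', n'))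
    (T : {linear 'M[R]_(m, n) -> 'M[R]_(m', n')}) :
  quadratic (fun x => 2^-1 * dot (mask0 c (T x)) (mask0 c (T x)))
    (fun x => adjoint T (mask0 c (T x)))
    (adjoint (@mask0 R m' n' c \o T) \o (@mask0 R m' n' c \o T)).
Proof.
apply: quadratic_ext (quadratic_sq (@mask0 R m' n' c \o T)) => // x.
by apply: dot_ext => w; rewrite !adjointP /= dot_mask0.
Qed.

Lemma quadratic_tq_piece (R : realType) m n m0 n0 md (lam mu : R)
    (A : {linear 'M[R]_(m, n) -> 'M[R]_(m0, n0)}) x0 c :
  0 <= mu ->
  exists H, quadratic (tq_piece md lam mu A x0 c) (tq_piece_grad mu A x0 c) H.
Proof.
move=> mu0; eexists.
apply: quadratic_ext (quadraticD (quadraticD (quadratic_lsq A x0)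
  (quadraticZ mu0 (quadraticD (quadratic_mask0 c.1 (@nabla1 R m n))
     (quadratic_mask0 c.2 (@nabla2 R m n)))))
  (quadratic_cst m n (tq_piece_cst md lam mu c))) => // x.
by rewrite addr0.
Qed.

Lemma tq_piece_ge0 (R : realType) m n m0 n0 md (lam mu : R)
    (A : 'M[R]_(m, n) -> 'M[R]_(m0, n0)) x0 c x :
  0 < lam -> 0 < mu -> 0 <= tq_piece md lam mu A x0 c x.
Proof.
move=> lam0 mu0.
have k0 : 0 <= lam / mu by rewrite divr_ge0 ?ltW.
rewrite /tq_piece !addr_ge0 ?mulr_ge0 ?addr_ge0 ?mulr_ge0 ?invr_ge0 ?dot_ge0//.
  exact: ltW.
do 2![apply: sumr_ge0 => ? _]; rewrite mulr_ge0 ?divr_ge0 ?(ltW mu0)//.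
by case: md; do ?case: ifP => _; rewrite ?addr_ge0.
Qed.

Lemma sqr_nabla_abs (R : realType) m n (x : 'M[R]_(m, n)) i j :
  nabla_abs x i j ^+ 2 = nabla1 x i j ^+ 2 + nabla2 x i j ^+ 2.
Proof. by rewrite sqr_sqrtr// addr_ge0 ?sqr_ge0. Qed.

Lemma min_sqrE (R : realType) (k a : R) : 0 <= a ->
  Num.min (a ^+ 2) k = if Num.sqrt k <= a then k else a ^+ 2.
Proof.
move=> a0; rewrite -{2}(ger0_norm a0) -sqrtr_sqr.
have [k0|k0] := leP 0 k.
  by rewrite ler_sqrt ?sqr_ge0// minEle; case: ltgtP.
(* The root of a negative [k] is 0 by convention, so the test succeeds and the minimum is [k]. *)
rewrite ltr0_sqrtr// sqrtr_ge0; apply/min_idPr; apply: le_trans (sqr_ge0 a).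
exact: ltW.
Qed.

(** Pixel by pixel the minimum is the constant exactly where the weight reaches the threshold. Ties
    count as truncated on both sides. *)
Lemma tq_pieceE (R : realType) m n m0 n0 md (lam mu : R)
    (A : 'M[R]_(m, n) -> 'M[R]_(m0, n0)) x0 x :
  tq md lam mu A x0 x =
  tq_piece md lam mu A x0 (tq_trunc md (Num.sqrt (lam / mu)) x) x.
Proof.
rewrite /tq /tq_piece /data_term enorm_sqr -addrA; congr (_ + _).
rewrite -mulrDr mulrA /dot -big_split mulr_sumr -big_split.
have -> : tq_reg md lam mu x = \sum_i \sum_j mu / 2 * match md with
  | ITQ => Num.min (nabla_abs x i j ^+ 2) (lam / mu)
  | ATQ => Num.min (`|nabla1 x i j| ^+ 2) (lam / mu)
              + Num.min (`|nabla2 x i j| ^+ 2) (lam / mu) end by case: md.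
apply: eq_bigr => i _ /=.
rewrite -big_split mulr_sumr -big_split; apply: eq_bigr => j _ /=.
rewrite -mulrDr; congr (_ * _); rewrite !mask0E !tq_truncE1 !tq_truncE2.
case: md => /=.
  rewrite min_sqrE ?sqrtr_ge0// sqr_nabla_abs.
  by case: ifP; rewrite ?mul0r ?add0r ?addr0 -?expr2.
rewrite !min_sqrE// !real_normK ?num_real//.
by do 2?case: ifP => _; rewrite ?mul0r ?add0r ?addr0 -?expr2// addrC.
Qed.

(** * Gradients of the components of the decomposition *)

Definition tq_f_grad (R : realType) m n m0 n0 (sp : dc_split)
    (A : {linear 'M[R]_(m, n) -> 'M[R]_(m0, n0)}) (x0 : 'M[R]_(m0, n0))
    (x : 'M[R]_(m, n)) : 'M[R]_(m, n) :=
  if sp is DataInSmooth then adjoint A (A x - x0) else 0.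

Definition tq_P1_grad (R : realType) m n m0 n0 (sp : dc_split) (mu : R)
    (A : {linear 'M[R]_(m, n) -> 'M[R]_(m0, n0)}) (x0 : 'M[R]_(m0, n0))
    (x : 'M[R]_(m, n)) : 'M[R]_(m, n) :=
  (if sp is DataInSmooth then 0 else adjoint A (A x - x0)) +
  mu *: (adjoint (@nabla1 R m n) (nabla1 x)
         + adjoint (@nabla2 R m n) (nabla2 x)).

Lemma quadratic_tq_f (R : realType) m n m0 n0 sp
    (A : {linear 'M[R]_(m, n) -> 'M[R]_(m0, n0)}) x0 :
  exists H, quadratic (tq_f sp A x0) (tq_f_grad sp A x0) H.
Proof.
case: sp; last by eexists; exact: quadratic_cst.
eexists; apply: quadratic_ext (quadratic_lsq A x0) => // x.
by rewrite /= /data_term enorm_sqr.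
Qed.

(** The squared modulus of the gradient is the sum of the two squared differences, so the models
    differ here only by a constant, with [lam / mu] counted once or twice per pixel. *)
Lemma quad_regE (R : realType) m n md (lam mu : R) :
  exists k, forall x : 'M[R]_(m, n), quad_reg md lam mu x =
    mu * (2^-1 * dot (nabla1 x) (nabla1 x) + 2^-1 * dot (nabla2 x) (nabla2 x))
    + k.
Proof.
pose k := mu / 2 * if md is ITQ then lam / mu else lam / mu + lam / mu.
exists (\sum_(i < m) \sum_(j < n) k) => x.
have -> : quad_reg md lam mu x = \sum_i \sum_j (mu / 2 *
    (nabla1 x i j * nabla1 x i j + nabla2 x i j * nabla2 x i j) + k).
  rewrite {}/k; case: md => /=; apply: eq_bigr => i _; apply: eq_bigr => j _.
    by rewrite sqr_nabla_abs !expr2 mulrDr.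
  by rewrite -mulrDr !real_normK ?num_real// !expr2 addrACA.
rewrite -mulrDr mulrA /dot -big_split mulr_sumr -big_split.
apply: eq_bigr => i _ /=; rewrite -big_split mulr_sumr -big_split.
by apply: eq_bigr.
Qed.

Lemma quadratic_tq_P1 (R : realType) m n m0 n0 md sp (lam mu : R)
    (A : {linear 'M[R]_(m, n) -> 'M[R]_(m0, n0)}) x0 :
  0 <= mu ->
  exists H, quadratic (tq_P1 md sp lam mu A x0) (tq_P1_grad sp mu A x0) H.
Proof.
move=> mu0; have [k kE] := quad_regE m n md lam mu.
have Q := quadraticD
  (quadraticZ mu0 (quadraticD (quadratic_sq (@nabla1 R m n))
                              (quadratic_sq (@nabla2 R m n))))
  (quadratic_cst m n k).
case: sp; eexists.
  by apply: quadratic_ext Q => x; rewrite /= ?kE// /tq_P1_grad add0r addr0.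
apply: quadratic_ext (quadraticD (quadratic_lsq A x0) Q) => x.
  by rewrite /= kE /data_term enorm_sqr.
by rewrite /tq_P1_grad addr0.
Qed.

Lemma pixel_mask_mask0 (R : realType) m n (w : 'I_m -> 'I_n -> R) s
    (u : 'M[R]_(m, n)) :
  pixel_mask w s u = u - mask0 (\matrix_(i, j) (s <= w i j)) u.
Proof.
apply/matrixP => i j; rewrite !mxE.
by case: (s <= w i j); rewrite ?mul1r ?mul0r ?subr0 ?subrr.
Qed.

(** The prescribed subgradient cancels the regulariser's gradient on the truncated pixels. What
    remains belongs to the active piece, wherever the data term was placed. *)
Lemma tq_piece_gradE (R : realType) m n m0 n0 md sp (lam mu : R)
    (A : {linear 'M[R]_(m, n) -> 'M[R]_(m0, n0)}) x0 x :
  tq_f_grad sp A x0 x + tq_P1_grad sp mu A x0 x - tq_subgrad md lam mu x =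
  tq_piece_grad mu A x0 (tq_trunc md (Num.sqrt (lam / mu)) x) x.
Proof.
have -> : tq_subgrad md lam mu x = mu *: (
    adjoint (@nabla1 R m n) (pixel_mask (tq_weight md false x)
      (Num.sqrt (lam / mu)) (nabla1 x))
  + adjoint (@nabla2 R m n) (pixel_mask (tq_weight md true x)
      (Num.sqrt (lam / mu)) (nabla2 x))) by case: md.
rewrite /tq_f_grad /tq_P1_grad /tq_piece_grad !pixel_mask_mask0 /=.
have -> (a b : 'M[R]_(m, n)) : (if sp is DataInSmooth then a else 0) +
    ((if sp is DataInSmooth then 0 else a) + b) = a + b.
  by case: sp; rewrite ?add0r.
rewrite -addrA -scalerBr; congr (_ + _ *: _).
by rewrite !linearB /= opprD addrACA !subKr.
Qed.

(** * Continuity of the weights and of F *)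

Lemma continuous_sum (R : realType) (T : topologicalType) (I : finType)
    (F : I -> T -> R) :
  (forall i, continuous (F i)) -> continuous (fun x => \sum_i F i x).
Proof.
move=> h x; apply: cvg_big => [|i _]; [exact: add_continuous|exact: h].
Qed.

Lemma continuous_mul (R : realType) (T : topologicalType) (f g : T -> R) :
  continuous f -> continuous g -> continuous (fun x => f x * g x).
Proof. by move=> fc gc x; exact: cvgM (fc x) (gc x). Qed.

Lemma continuous_sqr (R : realType) (T : topologicalType) (f : T -> R) :
  continuous f -> continuous (fun x => f x ^+ 2).
Proof. by move=> fc; apply: continuous_mul. Qed.

Lemma continuous_add (R : realType) (T : topologicalType) (f g : T -> R) :
  continuous f -> continuous g -> continuous (fun x => f x + g x).
Proof. by move=> fc gc x; exact: cvgD (fc x) (gc x). Qed.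

Lemma continuous_linear_coord (R : realType) m n m' n'
    (T : {linear 'M[R]_(m, n) -> 'M[R]_(m', n')}) i j :
  continuous (fun x => T x i j).
Proof.
under eq_fun do rewrite linear_coordE.
apply: continuous_sum => k; apply: continuous_sum => l.
apply: continuous_mul; last exact: cst_continuous.
by move=> x; exact: coord_continuous.
Qed.

Lemma continuous_nabla_abs (R : realType) m n i j :
  continuous (fun x : 'M[R]_(m, n) => nabla_abs x i j).
Proof.
have h : continuous (fun x : 'M[R]_(m, n) =>
    nabla1 x i j ^+ 2 + nabla2 x i j ^+ 2).
  by apply: continuous_add; apply: continuous_sqr;
    exact: continuous_linear_coord.
by move=> x; exact: continuous_comp (h x) (@sqrt_continuous R _).
Qed.

Lemma continuous_tq_weight (R : realType) m n md l i j :
  continuous (fun x : 'M[R]_(m, n) => tq_weight md l x i j).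
Proof.
case: md => /=; first exact: continuous_nabla_abs.
by case: l => x; apply: (cvg_norm (continuous_linear_coord (x := x))).
Qed.

Lemma continuous_tq (R : realType) m n m0 n0 md (lam mu : R)
    (A : {linear 'M[R]_(m, n) -> 'M[R]_(m0, n0)}) x0 :
  continuous (tq md lam mu A x0).
Proof.
have cmin (f : 'M[R]_(m, n) -> R) k : continuous f ->
    continuous (fun x => Num.min (f x ^+ 2) k).
  move=> fc x; apply: (@continuous_min R _ (fun x => f x ^+ 2) (fun=> k)).
    exact: continuous_sqr fc x.
  exact: cst_continuous.
apply: continuous_add; last first.
  rewrite /tq_reg; case: md; apply: continuous_sum => i;
    apply: continuous_sum => j; apply: continuous_mul;
    (try exact: cst_continuous).
    exact: cmin (@continuous_nabla_abs _ _ _ i j).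
  apply: continuous_add; apply: cmin.
    exact: (@continuous_tq_weight _ _ _ ATQ false i j).
  exact: (@continuous_tq_weight _ _ _ ATQ true i j).
rewrite /data_term; under eq_fun do rewrite enorm_sqr.
apply: continuous_mul; first exact: cst_continuous.
apply: continuous_sum => i; apply: continuous_sum => j.
have c : continuous (fun y => (A y - x0) i j).
  under eq_fun do rewrite mxE.
  by apply: continuous_add;
    [exact: continuous_linear_coord|exact: cst_continuous].
exact: continuous_mul.
Qed.

(** * Regular and limiting subgradients of F *)

Lemma regular_subdiff_near (R : realType) m n (F : 'M[R]_(m, n) -> R) x xi :
  (\forall y \near x, F x + dot xi (y - x) <= F y) -> regular_subdiff F x xi.
Proof.
(* The lower limit is minus an infimum, over neighbourhoods, of suprema of the negated quotient; the
   single neighbourhood [V] suffices. *)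
move=> Fx; rewrite /regular_subdiff /= /limf_einf oppe_ge0.
set V := [set y | F x + dot xi (y - x) <= F y] in Fx.
apply: (@le_trans _ _ (ereal_sup [set (- ((F y - F x - dot xi (y - x))
   / enorm (y - x))%:E)%E | y in V])).
  apply: ereal_inf_lbound; exists V => //.
  exact: cvg_within Fx.
apply: ge_ereal_sup => _ [y Vy <-].
rewrite oppe_le0 lee_fin divr_ge0 ?sqrtr_ge0//.
by move: Vy; rewrite /V /=; lra.
Qed.

(** Approximations at radii 1/(k+1) form the required sequences, and continuity supplies the
    convergence of the values of [F]. *)
Lemma limiting_subdiff_approx (R : realType) m n (F : 'M[R]_(m, n) -> R) x xi :
  {for x, continuous F} ->
  (forall e, 0 < e -> exists z v,
     [/\ ball x e z, ball xi e v & regular_subdiff F z v]) ->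
  limiting_subdiff F x xi.
Proof.
move=> Fc h.
have /choice[p pP] (k : nat) : exists p : 'M[R]_(m, n) * 'M[R]_(m, n),
    [/\ ball x k.+1%:R^-1 p.1, ball xi k.+1%:R^-1 p.2 &
        regular_subdiff F p.1 p.2].
  by have [|z [v ?]] := h k.+1%:R^-1; [rewrite invr_gt0|exists (z, v)].
have lim (u : nat -> 'M[R]_(m, n)) y :
    (forall k, ball y k.+1%:R^-1 (u k)) -> u k @[k --> \oo] --> y.
  move=> uy; apply/cvg_ballP => e e0; near=> k.
  apply: le_ball (uy k); apply: ltW; near: k.
  exact: near_infty_natSinv_lt (PosNum e0).
have px : (p k).1 @[k --> \oo] --> x by apply: lim => k; have [] := pP k.
exists (fun k => (p k).1), (fun k => (p k).2); split=> //.
- exact: cvg_comp px Fc.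
- by apply: lim => k; have [] := pP k.
- by move=> k; have [] := pP k.
Unshelve. all: by end_near.
Qed.

Lemma near_forall (T : topologicalType) (I : finType) (x : T)
    (P : I -> T -> Prop) :
  (forall i, \forall y \near x, P i y) -> \forall y \near x, forall i, P i y.
Proof. exact: filter_forall. Qed.

(** When no weight sits on the threshold, continuity freezes the masks near [z]. There the
    functional is one convex quadratic, which lies above its tangent. *)
Lemma tq_regular_subdiff (R : realType) m n m0 n0 md (lam mu : R)
    (A : {linear 'M[R]_(m, n) -> 'M[R]_(m0, n0)}) x0 z :
  0 <= mu ->
  (forall l i j, tq_weight md l z i j != Num.sqrt (lam / mu)) ->
  regular_subdiff (tq md lam mu A x0) z
    (tq_piece_grad mu A x0 (tq_trunc md (Num.sqrt (lam / mu)) z) z).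
Proof.
move=> mu0; set s := Num.sqrt _ => zs; apply: regular_subdiff_near.
have [H [e _ _ p]] := quadratic_tq_piece md lam A x0 (tq_trunc md s z) mu0.
have nearw l i j : \forall y \near z,
    (s <= tq_weight md l y i j) = (s <= tq_weight md l z i j).
  have [ws|sw] := ltP (tq_weight md l z i j) s.
    near=> y; apply/negbTE; rewrite -ltNge; near: y.
    exact: cvgr_lt (@continuous_tq_weight R m n md l i j z) _ ws.
  have {}sw : s < tq_weight md l z i j by rewrite lt_neqAle sw eq_sym zs.
  near=> y; apply/ltW; near: y.
  exact: cvgr_gt (@continuous_tq_weight R m n md l i j z) _ sw.
have near_l l : \forall y \near z, forall i j,
    (s <= tq_weight md l y i j) = (s <= tq_weight md l z i j).
  by apply: near_forall => i; apply: near_forall => j; exact: nearw.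
near=> y.
have yE : tq_trunc md s y = tq_trunc md s z.
  by congr pair; apply/matrixP => i j; rewrite !mxE; move: i j;
    near: y; exact: near_l.
rewrite !tq_pieceE -/s yE -[in leRHS](subrKC z y) e lerDl.
by rewrite mulr_ge0 ?invr_ge0.
Unshelve. all: by end_near.
Qed.

Lemma tq_weightZ (R : realType) m n md l (a : R) (x : 'M[R]_(m, n)) i j :
  0 <= a -> tq_weight md l (a *: x) i j = a * tq_weight md l x i j.
Proof.
move=> a0.
have n1 : nabla1 (a *: x) i j = a * nabla1 x i j by rewrite linearZ_LR [LHS]mxE.
have n2 : nabla2 (a *: x) i j = a * nabla2 x i j by rewrite linearZ_LR [LHS]mxE.
case: md => /=; last by case: l; rewrite ?n1 ?n2 normrM ger0_norm.
rewrite /nabla_abs n1 n2 !exprMn -mulrDr.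
by rewrite sqrtrM ?sqr_ge0// sqrtr_sqr ger0_norm.
Qed.

(* Stretching moves the truncated pixels strictly beyond the threshold, so the
   gradient of the selected piece is a limit of regular subgradients. *)
Lemma tq_regular_subdiff_approx (R : realType) m n m0 n0 md (lam mu : R)
    (A : {linear 'M[R]_(m, n) -> 'M[R]_(m0, n0)}) x0 x U V :
  0 < lam -> 0 < mu -> nbhs x U ->
  nbhs (tq_piece_grad mu A x0 (tq_trunc md (Num.sqrt (lam / mu)) x) x) V ->
  exists z v, [/\ U z, V v & regular_subdiff (tq md lam mu A x0) z v].
Proof.
move=> lam0 mu0; set s := Num.sqrt _; set c := tq_trunc _ _ _.
have s0 : 0 < s by rewrite sqrtr_gt0 divr_gt0.
have [H [_ gE _ _]] := quadratic_tq_piece md lam A x0 c (ltW mu0).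
move=> Ux Vx.
have lim (a b : 'M[R]_(m, n)) : (a + e *: b) @[e --> (0 : R)^'+] --> a.
  rewrite -[X in _ --> X]addr0 -(scale0r b).
  by apply: cvgD; [exact: cvg_cst|apply: cvgZr_tmp; exact: cvg_within].
have zx := lim x x.
have gz : tq_piece_grad mu A x0 c (x + e *: x) @[e --> (0 : R)^'+] -->
    tq_piece_grad mu A x0 c x.
  have -> : (fun e => tq_piece_grad mu A x0 c (x + e *: x)) =
      (fun e => tq_piece_grad mu A x0 c x + e *: H x).
    by apply/funext => e; rewrite gE (linearZ_LR H).
  exact: lim.
(* Weights below the threshold stay below it by continuity; the others are multiplied by [1 + e] and
   strictly exceed it because [s] is positive. *)
have wz : \forall e \near (0 : R)^'+, forall l i j,
    (s <= tq_weight md l (x + e *: x) i j) = (s <= tq_weight md l x i j) /\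
    tq_weight md l (x + e *: x) i j != s.
  apply: (@filter_forall _ bool) => l; apply: (@filter_forall _ 'I_m) => i.
  apply: (@filter_forall _ 'I_n) => j.
  have wE e : 0 < e ->
      tq_weight md l (x + e *: x) i j = (1 + e) * tq_weight md l x i j.
    by move=> e0; rewrite -tq_weightZ ?addr_ge0 ?(ltW e0)// scalerDl scale1r.
  have [ws|sw] := ltP (tq_weight md l x i j) s.
    have wlim : (tq_weight md l (x + e *: x) i j) @[e --> (0 : R)^'+] -->
        tq_weight md l x i j.
      exact: cvg_comp zx (@continuous_tq_weight R m n md l i j x).
    near=> e; have : tq_weight md l (x + e *: x) i j < s.
      by near: e; exact: cvgr_lt wlim _ ws.
    by move=> lt; rewrite lt_eqF// leNgt lt.
  near=> e; have e0 : 0 < e by near: e; exact: nbhs_right_gt.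
  have lt : s < tq_weight md l (x + e *: x) i j by rewrite wE//; nra.
  by rewrite gt_eqF// ltW.
have [e [Ue Ve we]] : exists e, [/\ U (x + e *: x),
    V (tq_piece_grad mu A x0 c (x + e *: x)) &
    forall l i j,
    (s <= tq_weight md l (x + e *: x) i j) = (s <= tq_weight md l x i j) /\
    tq_weight md l (x + e *: x) i j != s].
  apply: (@filter_ex _ (0 : R)^'+); near=> e; split; near: e => //.
    exact: zx Ux.
  exact: gz Vx.
exists (x + e *: x), (tq_piece_grad mu A x0 c (x + e *: x)); split=> //.
have -> : c = tq_trunc md s (x + e *: x).
  by congr pair; apply/matrixP => i j; rewrite !mxE (proj1 (we _ i j)).
by apply: tq_regular_subdiff => [|l i j]; [exact: ltW|case: (we l i j)].
Unshelve. all: by end_near.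
Qed.

(** * Estimates for one proximal step *)

Lemma quadratic_hessian_le (R : realType) m n (f : 'M[R]_(m, n) -> R) gf Hf L :
  quadratic f gf Hf -> lipschitz_bound (grad f) L ->
  forall h, dot h (Hf h) <= L * dot h h.
Proof.
move=> Qf [L0 lipf] h.
have := lipf h 0; rewrite (quadratic_grad Qf) subr0 -{1}[h]add0r.
rewrite (quad_gradE Qf) addrAC subrr add0r => lip.
apply: le_trans (dot_le_enorm _ _) _.
rewrite -enorm_sqr expr2 mulrCA; apply: ler_wpM2l => //.
exact: sqrtr_ge0.
Qed.

Lemma linear_form_bounded (R : realType) m n
    (T : {linear 'M[R]_(m, n) -> 'M[R]_(m, n)}) :
  exists2 C, 0 <= C & forall u, dot u (T u) <= C * dot u u.
Proof.
have [C C0 CT] := linear_dot_bounded T; exists (1 + C) => [|u].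
  by rewrite addr_ge0.
have := CT u; have := dot_ge0 (u - T u); have := dot_ge0 u.
rewrite !(dotBl, dotBr) (dotC (T u) u) mulrDl mul1r.
by have := dot_ge0 (T u); lra.
Qed.

(** The subproblem is a quadratic whose Hessian is that of [P] plus [M]; expanding it around its
    minimiser leaves at least half the squared [M]-norm. *)
Lemma prox_step_stationary (R : realType) m n (P : 'M[R]_(m, n) -> R) gP HP
    (M : {linear 'M[R]_(m, n) -> 'M[R]_(m, n)}) v y z :
  quadratic P gP HP -> self_adjoint M -> (forall h, 0 <= dot h (M h)) ->
  is_argmin (fun w => dot v w + 2^-1 * sqnorm_op M (w - y) + P w) z ->
  v + M (z - y) + gP z = 0 /\
  forall w, dot v z + 2^-1 * sqnorm_op M (z - y) + P z
      + 2^-1 * sqnorm_op M (w - z)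
    <= dot v w + 2^-1 * sqnorm_op M (w - y) + P w.
Proof.
move=> QP Ms Mp zmin.
have Q :=
  quadraticD (quadraticD (quadratic_linear v) (quadratic_op y Ms Mp)) QP.
have g0 := quadratic_argmin Q zmin; split=> // w.
have := quadE Q z (w - z); rewrite g0 dot0l addr0 subrKC /= add0r => ->.
rewrite lerD2l ler_wpM2l ?invr_ge0// dotDr lerDl.
exact: quad_ge0 QP _.
Qed.

(** Four inequalities are added: the proximal one tested at [x], the subgradient one for [P2], the
    majorisation of [f z] by its expansion at [y] with [M] as curvature, and the convexity of [f]
    between [y] and [x]. The terms in [z - y] cancel. *)
Lemma prox_dca_descent (R : realType) m n (f P1 P2 : 'M[R]_(m, n) -> R)
    gf Hf gP HP (M : {linear 'M[R]_(m, n) -> 'M[R]_(m, n)}) x y z xi :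
  quadratic f gf Hf -> quadratic P1 gP HP ->
  self_adjoint M -> (forall h, 0 <= dot h (M h)) ->
  (forall h, dot h (Hf h) <= dot h (M h)) ->
  convex_subdiff P2 x xi ->
  is_argmin
    (fun w => dot (gf y - xi) w + 2^-1 * sqnorm_op M (w - y) + P1 w) z ->
  f z + P1 z - P2 z + 2^-1 * sqnorm_op M (z - x) <=
  f x + P1 x - P2 x + 2^-1 * sqnorm_op M (x - y).
Proof.
move=> Qf QP Ms Mp fM xiP zmin.
have [_ /(_ x)] := prox_step_stationary QP Ms Mp zmin.
have := xiP z.
have := quadE Qf y (z - y); have := quadE Qf y (x - y).
rewrite !subrKC => -> ->.
have := fM (z - y); have := quad_ge0 Qf (x - y).
rewrite !(dotBl (gf y)) !(dotBr _ _ (gf y)) !(dotBr _ _ xi).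
have -> : sqnorm_op M (x - z) = sqnorm_op M (z - x).
  by rewrite /sqnorm_op -(opprB z) linearN dotNl dotNr opprK.
rewrite -/(sqnorm_op M (z - y)).
lra.
Qed.

(** Every piece is nonnegative, hence has its own error bound; summing the constants over the
    finitely many masks gives a common one. *)
Lemma tq_piece_error_bound (R : realType) m n m0 n0 md (lam mu : R)
    (A : {linear 'M[R]_(m, n) -> 'M[R]_(m0, n0)}) x0 :
  0 < lam -> 0 < mu ->
  exists q C, 0 <= C /\ forall c x, q c <= tq_piece md lam mu A x0 c x <=
    q c + C * dot (tq_piece_grad mu A x0 c x) (tq_piece_grad mu A x0 c x).
Proof.
move=> lam0 mu0.
have /choice[p pP] c : exists p : R * R, 0 <= p.2 /\ forall x,
    p.1 <= tq_piece md lam mu A x0 c x <= p.1 +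
    p.2 * dot (tq_piece_grad mu A x0 c x) (tq_piece_grad mu A x0 c x).
  have [H QH] := quadratic_tq_piece md lam A x0 c (ltW mu0).
  have [q [C [C0 qC]]] := quadratic_error_bound QH
    (fun x => tq_piece_ge0 md A x0 c x lam0 mu0).
  by exists (q, C).
exists (fun c => (p c).1), (\sum_c (p c).2); split=> [|c x].
  by apply: sumr_ge0 => c _; case: (pP c).
have [_ /(_ x)/andP[-> /= h]] := pP c.
apply: (le_trans h); rewrite lerD2l ler_wpM2r ?dot_ge0// (bigD1 c)//= lerDl.
by apply: sumr_ge0 => d _; case: (pP d).
Qed.

(** Subtracting the optimality condition eliminates [xi] and expresses [g] linearly in [x - y] and
    [z - x]. *)
Lemma prox_dca_residual (R : realType) m n (f P1 : 'M[R]_(m, n) -> R)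
    gf Hf gP HP (M : {linear 'M[R]_(m, n) -> 'M[R]_(m, n)}) :
  quadratic f gf Hf -> quadratic P1 gP HP ->
  exists2 C, 0 <= C & forall x y z xi g,
    gf y - xi + M (z - y) + gP z = 0 -> g = gf x + gP x - xi ->
    dot g g <= C * (dot (x - y) (x - y) + dot (z - x) (z - x)).
Proof.
move=> Qf QP.
have [C C0 CT] := linear_dot_bounded (Hf \- M).
have [D D0 DT] := linear_dot_bounded (HP \+ M).
exists (2 * (C + D)) => [|x y z xi g st gE].
  by rewrite mulr_ge0 ?addr_ge0.
have -> : g = (Hf \- M) (x - y) - (HP \+ M) (z - x).
  have := quad_gradE Qf y (x - y); rewrite subrKC => gfE.
  have := quad_gradE QP x (z - x); rewrite subrKC => gPE.
  have Mz : M (z - y) = M (z - x) + M (x - y) by rewrite -linearD addrA subrK.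
  apply/subr0_eq; rewrite -[RHS]st gE gfE gPE Mz /=.
  apply/matrixP => i j; rewrite !mxE; ring.
have := CT (x - y); have := DT (z - x).
have := sqr_dotD_le ((Hf \- M) (x - y)) (- (HP \+ M) (z - x)).
rewrite dotNl dotNr opprK.
have := mulr_ge0 C0 (dot_ge0 (z - x)); have := mulr_ge0 D0 (dot_ge0 (x - y)).
lra.
Qed.

Lemma sup_range_lt1 (R : realType) (beta : nat -> R) :
  (forall t, 0 <= beta t < 1) -> sup (range beta) < 1 ->
  exists2 b, 0 <= b < 1 & forall t, 0 <= beta t <= b.
Proof.
move=> b01 b1.
have bs t : beta t <= sup (range beta).
  apply: ub_le_sup; last by exists t.
  by exists 1 => _ [k _ <-]; case/andP: (b01 k) => _ /ltW.
exists (sup (range beta)) => [|t]; last by rewrite bs andbT; case/andP: (b01 t).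
by rewrite b1 andbT; apply: le_trans (bs 0%N); case/andP: (b01 0%N).
Qed.

(** Balls are those of the max-entry norm, which the Euclidean norm dominates. *)
Lemma ball0_dot (R : realType) m n (u : 'M[R]_(m, n)) (e : R) :
  0 < e -> dot u u < e ^+ 2 -> ball (0 : 'M[R]_(m, n)) e u.
Proof.
move=> e0 ue; split=> // i j.
rewrite /ball /= mxE sub0r normrN -(ltr_pXn2r (ltn0Sn 1)) ?nnegrE ?(ltW e0)//.
rewrite real_normK ?num_real//.
exact: le_lt_trans (sqr_coord_le_dot _ _ _) ue.
Qed.

(** * Convergence of the algorithm *)

Lemma preDCAe_tq_finite_length (R : realType) (m n m0 n0 : nat) (lam mu : R)
    (A : {linear 'M[R]_(m, n) -> 'M[R]_(m0, n0)}) (x0 : 'M[R]_(m0, n0))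
    (md : tq_model) (sp : dc_split) (L L0 : R)
    (M : {linear 'M[R]_(m, n) -> 'M[R]_(m, n)})
    (beta : nat -> R) (x xi : nat -> 'M[R]_(m, n)) :
  0 < lam -> 0 < mu ->
  lipschitz_bound (grad (tq_f sp A x0)) L ->
  0 < L0 -> L <= L0 ->
  self_adjoint M -> loewner_le (fun v => L0 *: v) M ->
  preDCAe (tq_f sp A x0) (tq_P1 md sp lam mu A x0) (tq_P2 md lam mu)
    M beta x xi ->
  (forall t, xi t = tq_subgrad md lam mu (x t)) ->
  let g t := tq_piece_grad mu A x0
    (tq_trunc md (Num.sqrt (lam / mu)) (x t)) (x t) in
  dot (g t) (g t) @[t --> \oo] --> 0 /\
  exists B, forall T, \sum_(0 <= t < T) enorm (x t - x t.-1) <= B.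
Proof.
move=> lam0 mu0 lip L00 LL0 Msym MI [b01 b1 step] xiE g.
have [b /andP[b0 {}b1] bb] := sup_range_lt1 b01 b1.
pose s := Num.sqrt (lam / mu).
pose c t := tq_trunc md s (x t).
pose F t := tq md lam mu A x0 (x t).
pose a t := dot (x t - x t.-1) (x t - x t.-1).
pose N t := sqnorm_op M (x t - x t.-1).
have ML h : L0 * dot h h <= dot h (M h).
  by have := MI h; rewrite dotBr dotZr subr_ge0.
have Mp h : 0 <= dot h (M h).
  by apply: le_trans (ML h); rewrite mulr_ge0 ?(ltW L00) ?dot_ge0.
have [Hf Qf] := quadratic_tq_f sp A x0.
have [HP QP] := quadratic_tq_P1 md sp lam A x0 (ltW mu0).
have fM h : dot h (Hf h) <= dot h (M h).
  apply: le_trans (ML h); apply: le_trans (quadratic_hessian_le Qf lip h) _.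
  by apply: ler_wpM2r; rewrite ?dot_ge0.
have [C1 C10 C1P] := linear_form_bounded M.
have [q [C2 [C20 C2P]]] := tq_piece_error_bound md A x0 lam0 mu0.
have [C3 C30 C3P] := prox_dca_residual M Qf QP.
have a0 t : 0 <= a t by exact: dot_ge0.
have descent t : F t.+1 + 2^-1 * N t.+1 <= F t + 2^-1 * (beta t ^+ 2 * N t).
  have [xiP xmin] := step t; rewrite (quadratic_grad Qf) in xmin.
  have := prox_dca_descent Qf QP Msym Mp fM xiP xmin.
  rewrite -!tq_decomposition opprD addNKr => /le_trans; apply.
  rewrite /N /sqnorm_op linearN (linearZ_LR M) dotNl dotNr opprK dotZl dotZr.
  by rewrite mulrA -expr2.
have residual t : dot (g t) (g t) <= C3 * (a t + a t.+1).
  have [_ xmin] := step t; rewrite (quadratic_grad Qf) in xmin.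
  have [st _] := prox_step_stationary QP Msym Mp xmin.
  have := C3P (x t) _ _ _ (g t) st; rewrite xiE tq_piece_gradE => /(_ erefl).
  move=> /le_trans; apply; apply: ler_wpM2l => //; rewrite lerD2r.
  (* The extrapolation displaces [x t] by [beta t] times the previous step, and
     [beta t ^+ 2 <= 1]. *)
  rewrite opprD addNKr dotNl dotNr opprK dotZl dotZr mulrA -/(a t).
  rewrite ler_piMl// -expr2 expr_le1//; case/andP: (bb t) => // _ /le_trans.
  by apply; exact: ltW.
have [acvg [B sumB]] : a t @[t --> \oo] --> 0 /\
    exists B, forall T, \sum_(0 <= t < T) Num.sqrt (a t) <= B.
  (* The energy drops by at least half of [(1 - b ^+ 2) * N t], and [N t >= L0 * a t]. [C1] compares
     energy and objective, [C2 * C3] combines the error bound with the residual bound. *)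
  apply: (@finite_value_descent R _ q c F (fun t => F t + 2^-1 * N t) a
    (2^-1 * (1 - b ^+ 2) * L0) (C1 + C2 * C3)) => //.
  - by rewrite !mulr_gt0// ?invr_gt0// subr_gt0 expr_lt1.
  - by rewrite addr_ge0 ?mulr_ge0.
  - move=> t; rewrite addr_ge0 ?mulr_ge0 ?invr_ge0 ?Mp//.
    by rewrite /F tq_pieceE tq_piece_ge0.
  - move=> t; have := descent t.
    have : (1 - b ^+ 2) * (L0 * a t) <= (1 - b ^+ 2) * N t.
      apply: ler_wpM2l (ML _); rewrite subr_ge0 expr_le1//; exact: ltW.
    have : beta t ^+ 2 * N t <= b ^+ 2 * N t.
      apply: ler_wpM2r (Mp _) _ _ _; case/andP: (bb t) => ? ?.
      by rewrite ler_pXn2r// nnegrE.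
    by lra.
  - move=> t; rewrite lerDl mulr_ge0 ?invr_ge0 ?Mp//= lerD2l.
    have := C1P (x t - x t.-1); have := mulr_ge0 (mulr_ge0 C20 C30) (a0 t).
    have := Mp (x t - x t.-1); rewrite /N /sqnorm_op -/(a t).
    by lra.
  - move=> t; have /andP[h1 h2] := C2P (c t) (x t).
    rewrite /F tq_pieceE -/s -/(c t) h1 /=; apply: (le_trans h2).
    rewrite lerD2l.
    have := ler_wpM2l C20 (residual t); rewrite -/(c t) -/(g t).
    have := mulr_ge0 C10 (addr_ge0 (a0 t) (a0 t.+1)).
    by lra.
split; last by exists B.
have aS : a t.+1 @[t --> \oo] --> 0 by rewrite (cvg_shiftS a).
have h : (C3 * (a t + a t.+1)) @[t --> \oo] --> 0.
  rewrite -(mulr0 C3) -(addr0 0); apply: cvgMr; exact: cvgD acvg aS.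
apply: squeeze_cvgr h => /=; last exact: cvg_cst.
by near=> t; rewrite dot_ge0 residual.
Unshelve. all: by end_near.
Qed.

Theorem theorem3 (R : realType) (m n m0 n0 : nat) (lam mu : R)
    (A : {linear 'M[R]_(m, n) -> 'M[R]_(m0, n0)}) (x0 : 'M[R]_(m0, n0))
    (md : tq_model) (sp : dc_split) (L L0 : R)
    (M : {linear 'M[R]_(m, n) -> 'M[R]_(m, n)})
    (beta : nat -> R) (x xi : nat -> 'M[R]_(m, n)) :
  0 < lam -> 0 < mu ->
  level_bounded (tq md lam mu A x0) ->
  is_lipschitz_constant (grad (tq_f sp A x0)) L ->
  0 < L0 -> L <= L0 ->
  self_adjoint M -> loewner_le (fun v => L0 *: v) M ->
  preDCAe (tq_f sp A x0) (tq_P1 md sp lam mu A x0) (tq_P2 md lam mu)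
    M beta x xi ->
  (forall t, xi t = tq_subgrad md lam mu (x t)) ->
  (forall xbar, cluster (x t @[t --> \oo]) xbar ->
     limiting_subdiff (tq md lam mu A x0) xbar 0) /\
  (\sum_(1 <= t <oo) (enorm (x t - x t.-1))%:E < +oo)%E.
Proof.
move=> lam0 mu0 _ [lip _] L00 LL0 Msym MI alg xiE.
have [gcvg [B sumB]] :=
  preDCAe_tq_finite_length lam0 mu0 lip L00 LL0 Msym MI alg xiE.
split=> [xbar xclus|].
  apply: limiting_subdiff_approx => [|e e0]; first exact: continuous_tq.
  set s := Num.sqrt _ in gcvg.
  pose g t := tq_piece_grad mu A x0 (tq_trunc md s (x t)) (x t).
  have gsmall : \forall t \near \oo, dot (g t) (g t) < (e / 2) ^+ 2.
    by apply: cvgr_lt gcvg _ _; rewrite exprn_gt0// divr_gt0.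
  have e20 : 0 < e / 2 by rewrite divr_gt0.
  (* A cluster point yields an index with both a small gradient and an iterate near [xbar]; half of
     [e] is left for the passage to a regular subgradient. *)
  have [_ [[t gt <-] xt]] :
      [set x t | t in [set t | dot (g t) (g t) < (e / 2) ^+ 2]] `&`
      ball xbar (e / 2) !=set0.
    apply: xclus; last exact: nbhsx_ballx.
    by apply: filterS gsmall => t ?; exists t.
  have [z [v [zx vg sub]]] := @tq_regular_subdiff_approx R m n m0 n0 md lam mu A
    x0 (x t) _ _ lam0 mu0 (nbhsx_ballx _ _ e20) (nbhsx_ballx _ _ e20).
  exists z, v; split=> //; first by rewrite [e]splitr; exact: ball_triangle zx.
  by rewrite [e]splitr; exact: ball_triangle (ball0_dot e20 gt) vg.
apply: (@le_lt_trans _ _ B%:E); last exact: ltry.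
apply: lime_le.
  by apply: is_cvg_nneseries => *; rewrite lee_fin sqrtr_ge0.
near=> T; rewrite sumEFin lee_fin; apply: le_trans (sumB T).
have [->|T0] := posnP T; first by rewrite !big_geq.
by rewrite [leRHS](big_ltn T0) lerDr sqrtr_ge0.
Unshelve. all: by end_near.
Qed.
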